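(* Consider a three-node branch with real nonzero true parameters $a_{21}^0,a_{32}^0$ which is uniformly excited, i.e. $\sigma_i^2=\sigma^2>0$ for all excited nodes and $\lambda_j=\lambda>0$ for all measured nodes (same $\sigma^2,\lambda$ for both patterns below). Let $P^{\mathrm{I}}$ and $P^{\mathrm{II}}$ be the asymptotic covariance matrices of the estimates of $(a_{21},a_{32})$ under the excitation and measurement patterns (I) $\mathcal B=\{1,2\},\ \mathcal C=\{3\}$ and (II) $\mathcal B=\{1\},\ \mathcal C=\{2,3\}$, and let $\mathrm{var}(\hat a_{21}^{j}),\mathrm{var}(\hat a_{32}^{j})$ be the first and second diagonal entries of $P^{j}$. Then: 1. $\mathrm{tr}(P^{\mathrm{I}})<\mathrm{tr}(P^{\mathrm{II}})$ if and only if $[a_{21}^0]^2<[a_{32}^0]^2$; 2. if $a_{21}^0=a_{32}^0$ then $\mathrm{tr}(P^{\mathrm{I}})=\mathrm{tr}(P^{\mathrm{II}})$, but $\mathrm{var}(\hat a_{21}^{\mathrm{I}})>\mathrm{var}(\hat a_{21}^{\mathrm{II}})$ and $\mathrm{var}(\hat a_{32}^{\mathrm{I}})<\mathrm{var}(\hat a_{32}^{\mathrm{II}})$.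
   Context: A dynamic network with $n$ nodes is $w(t)=G^0(q)w(t)+Br(t)$, $y(t)=Cw(t)+e(t)$, $t\in\mathbb Z$, where $q$ is the forward shift operator ($qr(t)=r(t+1)$), $w(t)\in\mathbb R^n$ are the node signals, $r$ the external excitations, $y$ the measured outputs, $e$ the measurement noise. $B$ and $C$ are binary selection matrices; $\mathcal B$ is the set of nodes $i$ to which an external signal $r_i$ is applied, and $\mathcal C$ is the set of nodes $j$ that are measured, $y_j=w_j+e_j$. The pair $(\mathcal B,\mathcal C)$ is called an excitation and measurement pattern (EMP). The three-node branch has $G^0(q)=q^{-1}A^0$ where the only nonzero entries of $A^0\in\mathbb R^{3\times 3}$ are $a_{21}^0$ and $a_{32}^0$, i.e. $w_1(t)=r_1(t)$, $w_2(t)=a_{21}^0w_1(t-1)+r_2(t)$, $w_3(t)=a_{32}^0w_2(t-1)+r_3(t)$, with $r_i\equiv0$ if $i\notin\mathcal B$. Assumptions: the $r_i$, $i\in\mathcal B$, are mutually independent stationary zero-mean white noise processes with variances $\sigma_i^2>0$, uncorrelated with the noises; the $e_j$, $j\in\mathcal C$, are independent stationary Gaussian zero-mean white noise processes with variances $\lambda_j>0$. For a parameter vector $\theta=(a_{21},a_{32})$ (estimated as two independent parameters), let $G(q,\theta)$ be the network matrix with $a_{ij}$ in place of $a_{ij}^0$. The optimal one-step-ahead predictor is $\hat y(t|t-1;\theta)=C(I-G(q,\theta))^{-1}Br(t)$. Let $\psi(t)$ be the $2\times|\mathcal C|$ matrix whose entry in the row of parameter $\theta_k$ and column of output $j\in\mathcal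 C$ is $\partial \hat y_j(t|t-1;\theta)/\partial\theta_k$ evaluated at the true parameter, and $\Lambda=\mathrm{diag}(\lambda_j)_{j\in\mathcal C}$. The asymptotic covariance matrix of the EMP is $P=[\mathbb E\,\psi(t)\Lambda^{-1}\psi(t)^T]^{-1}$. *)

(* Defs.v *)
(* MathComp / MathComp-Analysis. *)
From HB Require Import structures.
From mathcomp Require Import all_boot all_order all_algebra.
From mathcomp Require Import all_classical all_reals all_analysis.

Set Implicit Arguments.
Unset Strict Implicit.
Unset Printing Implicit Defensive.

Import Order.TTheory GRing.Theory Num.Theory.
Import numFieldNormedType.Exports.

Local Open Scope classical_set_scope.
Local Open Scope ring_scope.

(* Excitation and measurement pattern on n nodes. *)
Record emp (n : nat) :=
  Emp { excited : {set 'I_n} ; measured : {set 'I_n} }.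

(* The binary selection matrices B (n x #|excited|) and C (#|measured| x n);
   enum_val numbers the elements of a set of nodes in increasing order. *)
Definition excitation_mx (R : realType) (n : nat) (E : emp n) :
    'M[R]_(n, #|excited E|) :=
  \matrix_(i, k) (i == enum_val k)%:R.

Definition measurement_mx (R : realType) (n : nat) (E : emp n) :
    'M[R]_(#|measured E|, n) :=
  \matrix_(k, j) (j == enum_val k)%:R.

(* A matrix over {poly R} is read as a transfer matrix with 'X standing for
   the backward shift q^-1, so that it acts on two-sided vector signals. *)
Definition apply_tf (R : realType) (m n : nat) (M : 'M[{poly R}]_(m, n))
    (u : int -> 'cV[R]_n) (t : int) : 'cV[R]_m :=
  \col_i \sum_j \sum_(k < size (M i j)) (M i j)`_k * u (t - k%:Z) j 0.

(* Node-indexed scalar processes, stacked over the nodes of a set J. *)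
Definition stack (R : realType) (n : nat) (T : Type) (J : {set 'I_n})
    (x : 'I_n -> int -> T -> R) (t : int) (omega : T) : 'cV[R]_#|J| :=
  \col_k x (enum_val k) t omega.

(* The data equations  w = G(q) w + B r  and  y = C w + e. *)
Definition network_equations (R : realType) (n : nat) (T : Type) (E : emp n)
    (G : 'M[{poly R}]_n) (r e : 'I_n -> int -> T -> R)
    (w : int -> T -> 'cV[R]_n) (y : int -> T -> 'cV[R]_#|measured E|) : Prop :=
  forall (t : int) (omega : T),
    w t omega = apply_tf G (fun s => w s omega) t
                + excitation_mx R E *m stack (excited E) r t omega
    /\ y t omega = measurement_mx R E *m w t omega
                   + stack (measured E) e t omega.

(* Second-order (wide-sense) stationary zero-mean white noise. *)
Definition white_noise (R : realType) (d : measure_display)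
    (T : measurableType d) (P : probability T R)
    (X : int -> {RV P >-> R}) (v : R) : Prop :=
  [/\ forall t, (X t : T -> R) \in Lfun P 2%:E,
      forall t, expectation P (X t) = 0%E
    & forall t s, covariance P (X t) (X s) = (if t == s then v else 0)%:E].

(* All finite linear combinations have a normal law; point masses are listed
   separately because normal_prob m 0 is not a Dirac measure.  The second
   argument of normal_prob is the standard deviation. *)
Definition gaussian_process (R : realType) (d : measure_display)
    (T : measurableType d) (P : probability T R)
    (X : int -> {RV P >-> R}) : Prop :=
  forall (m : nat) (c : 'I_m -> R) (s : 'I_m -> int),
    let Z := fun omega => \sum_i c i * X (s i) omega in
    (exists mu sd : R, 0 < sd /\
       forall A : set R, measurable A -> P (Z @^-1` A) = normal_prob mu sd A)
    \/ (exists mu : R, P (Z @^-1` [set mu]) = 1%E).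

(* The events determined by a process: the sigma-algebra it generates. *)
Definition process_events (R : realType) (d : measure_display)
    (T : measurableType d) (P : probability T R)
    (X : int -> {RV P >-> R}) : set (set T) :=
  <<s [set A | exists t, exists2 U : set R, measurable U & A = X t @^-1` U] >>.

(* Mutual independence of the processes X i, i in J.  Since setT is an event of
   every process, the product rule for subfamilies of J is included. *)
Definition independent_processes (R : realType) (d : measure_display)
    (T : measurableType d) (P : probability T R) (n : nat)
    (J : {set 'I_n}) (X : 'I_n -> int -> {RV P >-> R}) : Prop :=
  forall A : 'I_n -> set T,
    (forall i, i \in J -> process_events (X i) (A i)) ->
    P (\bigcap_(i in [set` J]) A i) = (\prod_(i in J) P (A i))%E.

(* sigma2 i is the variance of r_i, lambda j the variance of e_j. *)
Record experiment (R : realType) (d : measure_display)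
    (T : measurableType d) (P : probability T R) (n : nat) (E : emp n)
    (G0 : 'M[{poly R}]_n) (sigma2 lambda : 'I_n -> R)
    (r e : 'I_n -> int -> {RV P >-> R})
    (w : int -> T -> 'cV[R]_n) (y : int -> T -> 'cV[R]_#|measured E|) : Prop :=
  Experiment {
    experiment_data : network_equations G0 r e w y ;
    excitation_white : forall i, i \in excited E -> white_noise (r i) (sigma2 i) ;
    excitation_indep : independent_processes (excited E) r ;
    noise_white : forall j, j \in measured E -> white_noise (e j) (lambda j) ;
    noise_gaussian : forall j, j \in measured E -> gaussian_process (e j) ;
    noise_indep : independent_processes (measured E) e ;
    excitation_noise_uncorrelated : forall i j, i \in excited E ->
      j \in measured E ->
      forall t s, covariance P (r i t) (e j s) = 0%E }.
Arguments experiment {R d T} P {n} E G0 sigma2 lambda r e w y.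

(* yhat(t|t-1; theta) = C (I - G(q, theta))^-1 B r(t).  The inverse is taken
   among matrices over {poly R}, so 1 - G(q, theta) has to be in unitmx; for the
   branch this is branch_network_unit below. *)
Definition predictor (R : realType) (n p : nat) (T : Type) (E : emp n)
    (G : 'rV[R]_p -> 'M[{poly R}]_n) (r : 'I_n -> int -> T -> R)
    (theta : 'rV[R]_p) (t : int) (omega : T) : 'cV[R]_#|measured E| :=
  measurement_mx R E *m
    apply_tf (invmx (1%:M - G theta))
      (fun s => excitation_mx R E *m stack (excited E) r s omega) t.

(* psi(t): the (k, j) entry is the partial derivative of the j-th predicted
   output with respect to the k-th parameter, at theta0. *)
Definition predictor_gradient (R : realType) (n p : nat) (T : Type) (E : emp n)
    (G : 'rV[R]_p -> 'M[{poly R}]_n) (r : 'I_n -> int -> T -> R)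
    (theta0 : 'rV[R]_p) (t : int) (omega : T) : 'M[R]_(p, #|measured E|) :=
  \matrix_(k, j) derive (fun theta => predictor E G r theta t omega j 0)
                        theta0 (delta_mx 0 k).

Definition noise_covariance (R : realType) (n : nat) (E : emp n)
    (lambda : 'I_n -> R) : 'M[R]_#|measured E| :=
  diag_mx (\row_k lambda (enum_val k)).

(* [E psi(t) Lambda^-1 psi(t)^T]^-1, with entrywise expectation. *)
Definition asymptotic_covariance (R : realType) (d : measure_display)
    (T : measurableType d) (P : probability T R) (n p : nat) (E : emp n)
    (G : 'rV[R]_p -> 'M[{poly R}]_n) (lambda : 'I_n -> R)
    (r : 'I_n -> int -> {RV P >-> R}) (theta0 : 'rV[R]_p) (t : int) : 'M[R]_p :=
  let psi := predictor_gradient E G r theta0 t in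
  invmx (\matrix_(k, l) fine (expectation P (fun omega =>
    (psi omega *m invmx (noise_covariance E lambda) *m (psi omega)^T) k l))).

Arguments asymptotic_covariance {R d T} P {n p} E G lambda r theta0 t.

Definition node1 : 'I_3 := @Ordinal 3 0 isT.
Definition node2 : 'I_3 := @Ordinal 3 1 isT.
Definition node3 : 'I_3 := @Ordinal 3 2 isT.

(* theta = (a21, a32). *)
Definition branch_param (R : realType) (a21 a32 : R) : 'rV[R]_2 :=
  \row_(k < 2) (if k == 0 then a21 else a32).

Definition branch_network (R : realType) (theta : 'rV[R]_2) : 'M[{poly R}]_3 :=
  'X *: map_mx polyC (theta 0 0 *: delta_mx node2 node1
                      + theta 0 1 *: delta_mx node3 node2).

Lemma branch_network_unit (R : realType) (theta : 'rV[R]_2) :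
  1%:M - branch_network theta \in unitmx.
Proof.
rewrite unitmxE det_trig.
  rewrite big1 ?unitr1// => i _; rewrite !mxE eqxx.
  by case: i => [[|[|[|]]]]//= hi; rewrite !(mulr0, addr0, subr0).
apply/is_trig_mxP => i j lij; rewrite !mxE.
by case: i j lij => [[|[|[|]]]]//= hi [[|[|[|]]]]//= hj _;
  rewrite !(mulr0, addr0, subr0).
Qed.

Definition pattern_I : emp 3 := Emp [set node1; node2] [set node3].
Definition pattern_II : emp 3 := Emp [set node1] [set node2; node3].

(* Main.v *)
Require Import Defs.
From mathcomp Require Import all_boot all_order all_algebra.
From mathcomp Require Import all_classical all_reals all_analysis.
From mathcomp Require Import measurable_realfun ring.

Set Implicit Arguments.
Unset Strict Implicit.
Unset Printing Implicit Defensive.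

Import Order.TTheory GRing.Theory Num.Theory.
Import numFieldNormedType.Exports.

Local Open Scope classical_set_scope.
Local Open Scope ring_scope.

(** The branch has a nilpotent gain matrix [A], with [A ^+ 3 = 0], so the
resolvent [(1 - 'X A)^-1] is the finite sum of the ['X^k A^k], and the predicted
output at each node is an explicit polynomial in the two parameters, affine in
each of them ([apply_tf_resolvent_nilpotent], [branch_predictorE]).  Its
sensitivities are therefore read off directly ([branch_predictor_gradientE]).  Put
[x = r_1(t-2)].  With pattern I only node 3 is measured and its sensitivities
with respect to [a21] and [a32] are

    [a32 x]   and   [a21 x + r_2(t-1)];

with pattern II the sensitivities of node 3 are [a32 x] and [a21 x], those of
node 2 are [r_1(t-1)] and [0].  In both cases two orthogonal variables of variance
[v = sigma^2] occur: for pattern II because [r_1] is white, for pattern I because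
[r_1] and [r_2] are independent and have zero mean
([indep_white_noises_orthogonal]).  The information matrices are thus [v / lambda]
times

    [a32^2, a32 a21; a32 a21, a21^2 + 1]   for pattern I,
    [a32^2 + 1, a32 a21; a32 a21, a21^2]   for pattern II,

of determinants [a32^2] and [a21^2] up to the factor [(v / lambda)^2].  Inverting
them, the variances of the two estimates are [lambda / v] times

    [(1 + a21^2) / a32^2]  and  [1]                    for pattern I,
    [1]                    and  [(1 + a32^2) / a21^2]  for pattern II

([branch_variances_I], [branch_variances_II]).  Comparing the traces amounts to
comparing [(1 + a21^2) a21^2] with [(1 + a32^2) a32^2], and [s |-> (1 + s) s] is
strictly increasing for positive [s].  When [a21 = a32] the two patterns exchange the variances of the estimates, and with
[s = a21^2] the larger of them is the one with the factor [(1 + s) / s > 1]. *)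

(** * Second moments of independent white noises *)

(** The product rule says that the law of the pair [(X, Y)] agrees with the
product of the two laws on rectangles, hence everywhere; the expectation of the
product is then computed by Fubini on the product of the laws. *)
Lemma expectation_mul_indep (R : realType) (d : measure_display)
    (T : measurableType d) (P : probability T R) (X Y : {RV P >-> R}) :
  (X : T -> R) \in Lfun P 1 -> (Y : T -> R) \in Lfun P 1 ->
  (X \* Y : T -> R) \in Lfun P 1 ->
  (forall A B : set R, measurable A -> measurable B ->
     P (X @^-1` A `&` Y @^-1` B) = (P (X @^-1` A) * P (Y @^-1` B))%E) ->
  expectation P (X \* Y) = (expectation P X * expectation P Y)%E.
Proof.
move=> X1 Y1 XY1 indep.
have mZ : measurable_fun [set: T] (fun w => (X w, Y w)).
  exact: measurable_fun_pair.
pose Z : {RV P >-> (R * R)%type} := mfun_Sub (mem_set mZ).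
pose f (z : R * R) : \bar R := (z.1 * z.2)%:E.
have mf : measurable_fun [set: R * R] f.
  by apply/measurable_EFinP; exact: measurable_funM.
have intf : P.-integrable setT (f \o Z) by exact/Lfun1_integrable.
have joint (A : set (R * R)) : measurable A -> A `<=` setT ->
    (distribution P X \x distribution P Y)%E A = distribution P Z A.
  move=> mA _; apply: product_measure_unique mA => B C mB mC.
  exact: indep.
have intfXY : (distribution P X \x distribution P Y)%E.-integrable setT f.
  apply/integrableP; split => //.
  rewrite (eq_measure_integral (distribution P Z) joint).
  rewrite ge0_integral_distribution//; last exact: measurableT_comp mf.
  by have /integrableP[] := intf.
have id_int (V : {RV P >-> R}) : (V : T -> R) \in Lfun P 1 ->
    (distribution P V).-integrable setT (EFin : R -> \bar R).
  move=> V1; apply: integrable_pushforward => //.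
  exact/Lfun1_integrable.
have mean (V : {RV P >-> R}) : (V : T -> R) \in Lfun P 1 ->
    (\int[distribution P V]_x x%:E = expectation P V)%E.
  move=> V1; rewrite unlock integral_distribution//; exact/Lfun1_integrable.
have -> : expectation P (X \* Y) = (\int[distribution P Z]_z f z)%E.
  by rewrite integral_distribution// unlock.
rewrite -(eq_measure_integral (distribution P Z) joint).
rewrite -integral12_prod_meas1//.
rewrite -[expectation P Y]fineK ?expectation_fin_num// -mean//.
rewrite -integralZr//; last exact: id_int.
apply: eq_integral => x _; rewrite /fubini_F /f /=.
under eq_integral do rewrite EFinM.
rewrite integralZl//; last exact: id_int.
by rewrite mean// fineK ?expectation_fin_num.
Qed.

(** The product rule over the whole family, applied to events that are trivial
except at [i] and [j]. *)
Lemma independent_processes_pair (R : realType) (d : measure_display)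
    (T : measurableType d) (P : probability T R) (n : nat) (J : {set 'I_n})
    (X : 'I_n -> int -> {RV P >-> R}) (i j : 'I_n) (t s : int) (A B : set R) :
  independent_processes J X -> i \in J -> j \in J -> i != j ->
  measurable A -> measurable B ->
  P (X i t @^-1` A `&` X j s @^-1` B) =
    (P (X i t @^-1` A) * P (X j s @^-1` B))%E.
Proof.
move=> indep iJ jJ ij mA mB.
pose C k : set T := if k == i then X i t @^-1` A
                    else if k == j then X j s @^-1` B else setT.
have Ci : C i = X i t @^-1` A by rewrite /C eqxx.
have Cj : C j = X j s @^-1` B by rewrite /C eq_sym (negbTE ij) eqxx.
have CT k : k != i -> k != j -> C k = setT.
  by move=> /negbTE ki /negbTE kj; rewrite /C ki kj.
have capC : \bigcap_(k in [set` J]) C k = X i t @^-1` A `&` X j s @^-1` B.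
  rewrite -Ci -Cj; apply/seteqP; split => [w Cw|w [Ciw Cjw] k _].
    by split; exact: Cw.
  have [->//|ki] := eqVneq k i; have [->//|kj] := eqVneq k j.
  by rewrite CT.
rewrite -capC indep => [|k _]; last first.
  have [->|ki] := eqVneq k i.
    by rewrite Ci; apply: sub_sigma_algebra; exists t, A.
  have [->|kj] := eqVneq k j.
    by rewrite Cj; apply: sub_sigma_algebra; exists s, B.
  by rewrite CT //; apply: sub_sigma_algebra; exists t, setT.
rewrite (bigD1 i)//= (bigD1 j)/= ?jJ 1?eq_sym// Ci Cj big1 ?mule1// => k.
by move=> /andP[/andP[_ ki] kj]; rewrite CT// probability_setT.
Qed.

Lemma white_noise_second_moment (R : realType) (d : measure_display)
    (T : measurableType d) (P : probability T R) (X : int -> {RV P >-> R})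
    (v : R) (t s : int) : white_noise X v ->
  expectation P (X t \* X s) = (if t == s then v else 0)%:E.
Proof.
move=> [X2 X0 covX].
have Pfin : P setT \is a fin_num := fin_num_measure P _ measurableT.
rewrite -covX covarianceE ?X0 ?mule0 ?sube0//.
- exact: (Lfun_subset12 Pfin).
- exact: (Lfun_subset12 Pfin).
- exact: Lfun2_mul_Lfun1.
Qed.

Lemma indep_white_noises_orthogonal (R : realType) (d : measure_display)
    (T : measurableType d) (P : probability T R) (n : nat) (J : {set 'I_n})
    (X : 'I_n -> int -> {RV P >-> R}) (v : 'I_n -> R) (i j : 'I_n)
    (t s : int) :
  independent_processes J X -> (forall k, k \in J -> white_noise (X k) (v k)) ->
  i \in J -> j \in J -> i != j -> expectation P (X i t \* X j s) = 0%E.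
Proof.
move=> indep white iJ jJ ij.
have [Xi2 Xi0 _] := white i iJ; have [Xj2 _ _] := white j jJ.
have Pfin : P setT \is a fin_num := fin_num_measure P _ measurableT.
rewrite expectation_mul_indep ?Xi0 ?mul0e//.
- exact: (Lfun_subset12 Pfin).
- exact: (Lfun_subset12 Pfin).
- exact: Lfun2_mul_Lfun1.
- by move=> A B mA mB; exact: (independent_processes_pair _ _ indep).
Qed.

(** All entries of the information matrices have this form, [X] and [Y] being two
orthogonal samples of the excitation. *)
Lemma expectation_quadratic_form (R : realType) (d : measure_display)
    (T : measurableType d) (P : probability T R) (X Y : T -> R)
    (v a b c : R) :
  X \in Lfun P 2%:E -> Y \in Lfun P 2%:E ->
  expectation P (X \* X) = v%:E -> expectation P (Y \* Y) = v%:E ->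
  expectation P (X \* Y) = 0%E ->
  expectation P (fun w => a * (X w * X w) + b * (X w * Y w) + c * (Y w * Y w))
    = ((a + c) * v)%:E.
Proof.
move=> X2 Y2 EXX EYY EXY.
have XX := Lfun2_mul_Lfun1 X2 X2.
have XY := Lfun2_mul_Lfun1 X2 Y2.
have YY := Lfun2_mul_Lfun1 Y2 Y2.
rewrite [X in expectation P X](_ : _ =
    a \o* (X \* X) \+ b \o* (X \* Y) \+ c \o* (Y \* Y)); last first.
  by apply/funext => w /=; ring.
rewrite !expectationD ?rpredD ?Lfun_scale//.
rewrite !expectationZl// EXX EXY EYY mule0 adde0 -!EFinM -EFinD.
by congr EFin; ring.
Qed.

(** * Differentiation, resolvents and inverses *)

(** Along [v] the difference quotient is the constant [D]. *)
Lemma derive_affine_direction (R : realType) (V : normedModType R)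
    (f : V -> R) (a v : V) (D : R) :
  (forall h : R, f (h *: v + a) = f a + h * D) -> 'D_v f a = D.
Proof.
move=> fE; apply: lim_near_cst => //.
near=> h; rewrite /= fE (addrC (f a)) addrK /GRing.scale/= mulKf//.
by near: h; exact: nbhs_dnbhs_neq.
Unshelve. all: by end_near. Qed.

(** The geometric series, cut off by nilpotency. *)
Lemma invmx_nilpotent (R : comUnitRingType) (n N : nat) (M : 'M[R]_n.+1) :
  M ^+ N = 0 -> invmx (1%:M - M) = \sum_(k < N) M ^+ k.
Proof.
move=> MN0.
have inv_r : (1%:M - M) *m (\sum_(k < N) M ^+ k) = 1%:M.
  have := subrX1 M N; rewrite MN0 sub0r => geo.
  by rewrite -[RHS]opprK [in RHS]geo -mulNr opprB.
have [U _] := mulmx1_unit inv_r.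
by rewrite -[RHS](mulKmx U) inv_r mulmx1.
Qed.

(** A common length [N] replaces the size of each entry, which depends on which
coefficients vanish. *)
Lemma apply_tf_poly (R : realType) (m n N : nat) (M : 'M[{poly R}]_(m, n))
    (C : nat -> 'M[R]_(m, n)) (u : int -> 'cV[R]_n) (t : int) :
  (forall i j, M i j = \poly_(k < N) C k i j) ->
  apply_tf M u t = \sum_(k < N) C k *m u (t - k%:Z).
Proof.
move=> ME; apply/colP => i; rewrite mxE summxE.
under [RHS]eq_bigr do rewrite mxE.
rewrite exchange_big/=; apply: eq_bigr => j _.
pose F k := (M i j)`_k * u (t - k%:Z) j 0.
have leN : (size (M i j) <= N)%N by rewrite ME size_poly.
rewrite (big_ord_widen _ F leN) big_mkcond/=; apply: eq_bigr => k _.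
case: ltnP => [_|/leq_sizeP/(_ k (leqnn k)) c0].
  by rewrite /F ME coef_poly ltn_ord.
by move: c0; rewrite ME coef_poly ltn_ord => ->; rewrite mul0r.
Qed.

(** The Markov-parameter expansion: the response of the network sums the delayed
inputs, each transported along paths of length [k] by [A ^+ k]. *)
Lemma apply_tf_resolvent_nilpotent (R : realType) (n N : nat) (A : 'M[R]_n.+1)
    (u : int -> 'cV[R]_n.+1) (t : int) :
  A ^+ N = 0 ->
  apply_tf (invmx (1%:M - 'X *: map_mx polyC A)) u t
    = \sum_(k < N) A ^+ k *m u (t - k%:Z).
Proof.
move=> AN0.
have powE k : ('X *: map_mx polyC A) ^+ k = 'X^k *: map_mx polyC (A ^+ k).
  by rewrite exprZn rmorphXn.
rewrite (@invmx_nilpotent _ _ N) => [|]; last by rewrite powE AN0 map_mx0 scaler0.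
apply: apply_tf_poly => i j; rewrite summxE poly_def.
by apply: eq_bigr => k _; rewrite powE !mxE mulrC mul_polyC.
Qed.

Lemma sum2E (V : nmodType) (F : 'I_2 -> V) : \sum_i F i = F 0 + F 1.
Proof.
by rewrite !big_ord_recl big_ord0 addr0; congr (_ + F _); apply: val_inj.
Qed.

Lemma ord2P (i : 'I_2) : i = 0 \/ i = 1.
Proof. by case: i => [[|[|//]]] ?; [left|right]; apply: val_inj. Qed.

Lemma invmx_2x2_diag (F : fieldType) (M : 'M[F]_2) :
  let D := M 0 0 * M 1 1 - M 0 1 * M 1 0 in
  D != 0 -> invmx M 0 0 = M 1 1 / D /\ invmx M 1 1 = M 0 0 / D.
Proof.
move=> D D0.
pose N : 'M[F]_2 := \matrix_(i, j)
  ((if i == 0 then if j == 0 then M 1 1 else - M 0 1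
              else if j == 0 then - M 1 0 else M 0 0) / D).
have MN : M *m N = 1%:M.
  apply/matrixP => i j; rewrite mxE sum2E !mxE /=.
  by case: (ord2P i) => ->; case: (ord2P j) => -> /=; rewrite /D in D0 *; field.
have [U _] := mulmx1_unit MN.
have -> : invmx M = N by rewrite -[RHS](mulKmx U) MN mulmx1.
by rewrite !mxE.
Qed.

(** * The predictor of the three-node branch and its gradient *)

Definition branch_gain (R : realType) (theta : 'rV[R]_2) : 'M[R]_3 :=
  theta 0 0 *: delta_mx node2 node1 + theta 0 1 *: delta_mx node3 node2.

Lemma branch_gain_mul (R : realType) (m : nat) (theta : 'rV[R]_2)
    (M : 'M[R]_(3, m)) (i : 'I_3) (j : 'I_m) :
  (branch_gain theta *m M) i j =
    if i == node2 then theta 0 0 * M node1 j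
    else if i == node3 then theta 0 1 * M node2 j else 0.
Proof.
rewrite mxE (bigD1 node1)//= (bigD1 node2)//= (bigD1 node3)//= big1; last first.
  by case=> [[|[|[|]]]].
rewrite /branch_gain !mxE !eqxx/= !andbF !andbT.
have [->|i2] := eqVneq i node2; last have [_|i3] := eqVneq i node3.
- by rewrite !(mulr1, mulr0, mul0r, addr0).
- by rewrite !(mulr1, mulr0, mul0r, addr0, add0r).
- by rewrite !(mulr1, mulr0, mul0r, addr0).
Qed.

Lemma branch_gain_nilpotent (R : realType) (theta : 'rV[R]_2) :
  branch_gain theta ^+ 3 = 0.
Proof.
apply/matrixP => i j; rewrite !exprS expr0 mulr1 /GRing.mul/=.
rewrite !branch_gain_mul/= !mxE/=.
by do 2?case: ifP => _; rewrite ?(mulr0, addr0).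
Qed.

Definition node_input (R : realType) (n : nat) (T : Type) (E : emp n)
    (r : 'I_n -> int -> T -> R) (omega : T) (i : 'I_n) (s : int) : R :=
  if i \in excited E then r i s omega else 0.

(** The signal [w_j(t)] that the branch produces from the node inputs [u]. *)
Definition branch_response (R : realType) (theta : 'rV[R]_2)
    (u : 'I_3 -> int -> R) (t : int) (j : 'I_3) : R :=
  u j t + if j == node2 then theta 0 0 * u node1 (t - 1)
          else if j == node3 then
            theta 0 1 * (u node2 (t - 1) + theta 0 0 * u node1 (t - 2))
          else 0.

(** The partial derivatives of [branch_response] with respect to [theta]. *)
Definition branch_sensitivity (R : realType) (theta : 'rV[R]_2)
    (u : 'I_3 -> int -> R) (t : int) (k : 'I_2) (j : 'I_3) : R :=
  if j == node2 then (k == 0)%:R * u node1 (t - 1)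
  else if j == node3 then
    if k == 0 then theta 0 1 * u node1 (t - 2)
    else u node2 (t - 1) + theta 0 0 * u node1 (t - 2)
  else 0.

Lemma excitation_mx_stack (R : realType) (n : nat) (T : Type) (E : emp n)
    (r : 'I_n -> int -> T -> R) (s : int) (omega : T) (i : 'I_n) :
  (excitation_mx R E *m stack (excited E) r s omega) i 0
    = node_input E r omega i s.
Proof.
rewrite mxE; under eq_bigr do rewrite !mxE.
rewrite -(big_enum_val (fun j => (i == j)%:R * r j s omega)) /node_input.
case: ifPn => iE.
  rewrite (bigD1 i)//= eqxx mul1r big1 ?addr0// => j /andP[_].
  by rewrite eq_sym => /negbTE ->; rewrite mul0r.
rewrite big1// => j jE; have [ij|_] := eqVneq i j; last by rewrite mul0r.
by rewrite -ij (negbTE iE) in jE.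
Qed.

Lemma measurement_mx_mul (R : realType) (n m : nat) (E : emp n)
    (M : 'M[R]_(n, m)) (k : 'I_#|measured E|) (l : 'I_m) :
  (measurement_mx R E *m M) k l = M (enum_val k) l.
Proof.
rewrite mxE (bigD1 (enum_val k))//= big1 ?addr0 ?mxE ?eqxx ?mul1r// => j.
by move=> /negbTE jk; rewrite mxE jk mul0r.
Qed.

Lemma branch_predictorE (R : realType) (T : Type) (E : emp 3)
    (r : 'I_3 -> int -> T -> R) (theta : 'rV[R]_2) (t : int) (omega : T)
    (k : 'I_#|measured E|) :
  predictor E (@branch_network R) r theta t omega k 0
    = branch_response theta (node_input E r omega) t (enum_val k).
Proof.
rewrite /predictor measurement_mx_mul.
rewrite (@apply_tf_resolvent_nilpotent _ _ 3); last first.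
  exact: branch_gain_nilpotent.
rewrite !big_ord_recl big_ord0 !addr0 expr0 expr1 expr2 mul1mx -mulmxA.
rewrite mxE [X in _ + X]mxE.
rewrite -/(branch_gain theta) !branch_gain_mul !excitation_mx_stack.
rewrite /branch_response /=.
by do 2?case: ifP => _; rewrite ?mulr0 ?addr0 ?mulrDr.
Qed.

Lemma branch_predictor_gradientE (R : realType) (T : Type) (E : emp 3)
    (r : 'I_3 -> int -> T -> R) (theta : 'rV[R]_2) (t : int) (omega : T)
    (k : 'I_2) (j : 'I_#|measured E|) :
  predictor_gradient E (@branch_network R) r theta t omega k j
    = branch_sensitivity theta (node_input E r omega) t k (enum_val j).
Proof.
rewrite mxE; apply: derive_affine_direction => h.
rewrite !branch_predictorE /branch_response /branch_sensitivity !mxE.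
by case: (ord2P k) => -> /=; do 2?case: ifP => _; ring.
Qed.

(** With uniform noise the weight [Lambda^-1] is the scalar [lambda^-1], and the
product [psi psi^T] becomes a sum over the measured nodes themselves instead of
their ranks. *)
Lemma branch_asymptotic_covarianceE (R : realType) (d : measure_display)
    (T : measurableType d) (P : probability T R) (E : emp 3) (lambda : R)
    (r : 'I_3 -> int -> {RV P >-> R}) (theta : 'rV[R]_2) (t : int) :
  let S omega := branch_sensitivity theta (node_input E r omega) t in
  asymptotic_covariance P E (@branch_network R) (fun=> lambda) r theta t
    = invmx (\matrix_(k, l) fine (expectation P (fun omega =>
        lambda^-1 * \sum_(j in measured E) S omega k j * S omega l j))).
Proof.
move=> S; congr invmx; apply/matrixP => k l; rewrite !mxE.
congr (fine (expectation P _)); apply/funext => omega.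
rewrite /noise_covariance [X in diag_mx X](_ : _ = const_mx lambda); last first.
  by apply/rowP => i; rewrite !mxE.
rewrite diag_const_mx invmx_scalar mul_mx_scalar -scalemxAl mxE mxE.
congr (_ * _); rewrite [RHS]big_enum_val/=; apply: eq_bigr => j _.
by rewrite [X in _ * X]mxE !branch_predictor_gradientE.
Qed.

(** * The variances under the two patterns *)

(** The excitation of node 2 contributes the term [1] to the information on
[a32]; independence of the two excitations kills the cross terms. *)
Lemma branch_variances_I (R : realType) (d : measure_display)
    (T : measurableType d) (P : probability T R) (a21 a32 v lambda : R)
    (r : 'I_3 -> int -> {RV P >-> R}) (t : int) :
  a32 != 0 -> v != 0 -> lambda != 0 ->
  (forall i, i \in excited pattern_I -> white_noise (r i) v) ->
  independent_processes (excited pattern_I) r ->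
  let C := asymptotic_covariance P pattern_I (@branch_network R)
             (fun=> lambda) r (branch_param a21 a32) t in
  C 0 0 = lambda / v * ((1 + a21 ^+ 2) / a32 ^+ 2) /\ C 1 1 = lambda / v.
Proof.
move=> a32_0 v0 lambda0 white indep C.
have E1 : node1 \in excited pattern_I by rewrite !inE.
have E2 : node2 \in excited pattern_I by rewrite !inE.
have [x2 _ _] := white _ E1; have [y2 _ _] := white _ E2.
have xx := white_noise_second_moment (t - 2) (t - 2) (white _ E1).
have yy := white_noise_second_moment (t - 1) (t - 1) (white _ E2).
have xy : expectation P (r node1 (t - 2) \* r node2 (t - 1)) = 0%E.
  exact: (indep_white_noises_orthogonal _ _ indep white).
rewrite !eqxx in xx yy.
(* The sensitivity at node 3 to parameter k is [p k * r_1(t-2)] plus, here,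
   [q k * r_2(t-1)]. *)
pose p (k : 'I_2) := if k == 0 then a32 else a21.
pose q (k : 'I_2) : R := (k == 1)%:R.
have CE : C = invmx (\matrix_(k, l) ((p k * p l + q k * q l) * (v / lambda))).
  rewrite /C branch_asymptotic_covarianceE; congr invmx.
  apply/matrixP => k l; rewrite !mxE.
  rewrite [X in expectation P X](_ : _ = fun w =>
      p k * p l / lambda * (r node1 (t - 2) w * r node1 (t - 2) w)
      + (p k * q l + q k * p l) / lambda
          * (r node1 (t - 2) w * r node2 (t - 1) w)
      + q k * q l / lambda * (r node2 (t - 1) w * r node2 (t - 1) w)).
    by rewrite (expectation_quadratic_form _ _ _ (x2 _) (y2 _) xx yy xy)/=; field.
  apply/funext => w; rewrite big_set1 /branch_sensitivity /= /node_input E1 E2.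
  rewrite !mxE /p /q.
  by case: (ord2P k) => ->; case: (ord2P l) => -> /=; field.
rewrite CE; set M := (\matrix_(_, _) _).
have DE : M 0 0 * M 1 1 - M 0 1 * M 1 0 = a32 ^+ 2 * (v / lambda) ^+ 2.
  by rewrite !mxE /p /q /=; ring.
have [|-> ->] := @invmx_2x2_diag _ M.
  by rewrite DE mulf_neq0// expf_neq0// mulf_neq0// invr_neq0.
by rewrite DE !mxE /p /q /=; split; field; rewrite ?a32_0 ?v0 ?lambda0.
Qed.

(** The measurement of node 2 contributes the term [1] to the information on
[a21]; it involves [r_1(t-1)], which whiteness makes orthogonal to the [r_1(t-2)]
seen at node 3. *)
Lemma branch_variances_II (R : realType) (d : measure_display)
    (T : measurableType d) (P : probability T R) (a21 a32 v lambda : R)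
    (r : 'I_3 -> int -> {RV P >-> R}) (t : int) :
  a21 != 0 -> v != 0 -> lambda != 0 -> white_noise (r node1) v ->
  let C := asymptotic_covariance P pattern_II (@branch_network R)
             (fun=> lambda) r (branch_param a21 a32) t in
  C 0 0 = lambda / v /\ C 1 1 = lambda / v * ((1 + a32 ^+ 2) / a21 ^+ 2).
Proof.
move=> a21_0 v0 lambda0 white C.
have E1 : node1 \in excited pattern_II by rewrite !inE.
have E2 : node2 \in excited pattern_II = false by rewrite !inE.
have [x2 _ _] := white.
have xx := white_noise_second_moment (t - 2) (t - 2) white.
have zz := white_noise_second_moment (t - 1) (t - 1) white.
have xz := white_noise_second_moment (t - 2) (t - 1) white.
have t21 : (t - 2 == t - 1) = false by apply/eqP => /addrI.
rewrite ?eqxx t21 in xx zz xz.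
(* [p k * r_1(t-2)] is the sensitivity to parameter k at node 3, and
   [q k * r_1(t-1)] the one at node 2. *)
pose p (k : 'I_2) := if k == 0 then a32 else a21.
pose q (k : 'I_2) : R := (k == 0)%:R.
have CE : C = invmx (\matrix_(k, l) ((p k * p l + q k * q l) * (v / lambda))).
  rewrite /C branch_asymptotic_covarianceE; congr invmx.
  apply/matrixP => k l; rewrite !mxE.
  rewrite [X in expectation P X](_ : _ = fun w =>
      p k * p l / lambda * (r node1 (t - 2) w * r node1 (t - 2) w)
      + 0 * (r node1 (t - 2) w * r node1 (t - 1) w)
      + q k * q l / lambda * (r node1 (t - 1) w * r node1 (t - 1) w)).
    by rewrite (expectation_quadratic_form _ _ _ (x2 _) (x2 _) xx zz xz)/=; field.
  apply/funext => w; rewrite big_setU1 ?inE// big_set1.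
  rewrite /branch_sensitivity /= /node_input E1 E2 !mxE /p /q.
  by case: (ord2P k) => ->; case: (ord2P l) => -> /=; field.
rewrite CE; set M := (\matrix_(_, _) _).
have DE : M 0 0 * M 1 1 - M 0 1 * M 1 0 = a21 ^+ 2 * (v / lambda) ^+ 2.
  by rewrite !mxE /p /q /=; ring.
have [|-> ->] := @invmx_2x2_diag _ M.
  by rewrite DE mulf_neq0// expf_neq0// mulf_neq0// invr_neq0.
by rewrite DE !mxE /p /q /=; split; field; rewrite ?a21_0 ?v0 ?lambda0.
Qed.

(** * Comparison of the two patterns *)

(** Clearing denominators, the difference of the two sides is [y - x] times the
positive factor [1 + x + y]. *)
Lemma variance_ratio_lt (F : realFieldType) (x y : F) : 0 < x -> 0 < y ->
  ((1 + x) / y < (1 + y) / x) = (x < y).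
Proof.
move=> x0 y0; rewrite ltr_pdivrMr// mulrAC ltr_pdivlMr// -subr_gt0.
have -> : (1 + y) * y - (1 + x) * x = (1 + x + y) * (y - x) by ring.
by rewrite pmulr_rgt0 ?subr_gt0// !addr_gt0.
Qed.

Theorem mainTheorem4 (R : realType) (a21 a32 sigma lambda : R)
    (ha21 : a21 != 0) (ha32 : a32 != 0)
    (hsigma : 0 < sigma ^+ 2) (hlambda : 0 < lambda)
    (d1 d2 : measure_display)
    (T1 : measurableType d1) (T2 : measurableType d2)
    (Pr1 : probability T1 R) (Pr2 : probability T2 R)
    (r1 e1 : 'I_3 -> int -> {RV Pr1 >-> R})
    (r2 e2 : 'I_3 -> int -> {RV Pr2 >-> R})
    (w1 : int -> T1 -> 'cV[R]_3) (w2 : int -> T2 -> 'cV[R]_3)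
    (y1 : int -> T1 -> 'cV[R]_#|measured pattern_I|)
    (y2 : int -> T2 -> 'cV[R]_#|measured pattern_II|)
    (hI : experiment Pr1 pattern_I (branch_network (branch_param a21 a32))
            (fun=> sigma ^+ 2) (fun=> lambda) r1 e1 w1 y1)
    (hII : experiment Pr2 pattern_II (branch_network (branch_param a21 a32))
             (fun=> sigma ^+ 2) (fun=> lambda) r2 e2 w2 y2)
    (t1 t2 : int) :
  let PI := asymptotic_covariance Pr1 pattern_I (@branch_network R)
              (fun=> lambda) r1 (branch_param a21 a32) t1 in
  let PII := asymptotic_covariance Pr2 pattern_II (@branch_network R)
               (fun=> lambda) r2 (branch_param a21 a32) t2 in
  (\tr PI < \tr PII <-> a21 ^+ 2 < a32 ^+ 2) /\
  (a21 = a32 ->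
     [/\ \tr PI = \tr PII, PI 0 0 > PII 0 0 & PI 1 1 < PII 1 1]).
Proof.
move=> PI PII.
have sigma0 := lt0r_neq0 hsigma; have lambda0 := lt0r_neq0 hlambda.
have [I0 I1] := branch_variances_I a21 t1 ha32 sigma0 lambda0
  (excitation_white hI) (excitation_indep hI).
have in1 : node1 \in excited pattern_II by rewrite !inE.
have [II0 II1] := branch_variances_II a32 t2 ha21 sigma0 lambda0
  (excitation_white hII in1).
have K0 : 0 < lambda / sigma ^+ 2 by rewrite divr_gt0.
have sqr0 (a : R) : a != 0 -> 0 < a ^+ 2 by move=> a0; rewrite exprn_even_gt0.
rewrite /mxtrace !sum2E /PI /PII I0 I1 II0 II1; split.
  by rewrite addrC ltrD2l ltr_pM2l// variance_ratio_lt ?sqr0.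
move=> a_eq; subst a32; rewrite addrC; split => //.
  by rewrite ltr_pMr// ltr_pdivlMr ?sqr0// mul1r ltrDr.
by rewrite ltr_pMr// ltr_pdivlMr ?sqr0// mul1r ltrDr.
Qed.
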